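(* Let $k=2^{l_+}$ be a sufficiently large integer with $2k<n$, and let $l<l_+$ satisfy $2^{l_+-l}\ge 6$. Let $f\in\mathbb C$, $|f|=1$, $t_j=f\exp(2\pi j\sqrt{-1}/n)$ for $j=0,\dots,n-1$, let $s_0,\dots,s_{m-1}\in\mathbb C\setminus\{t_0,\dots,t_{n-1}\}$, and let $C=\left(\frac1{s_i-t_j}\right)_{i,j=0}^{m-1,n-1}$ be the corresponding CV matrix with the block partition induced by the uniform $k$-partition of its knot sets. Then both $C$ and $C^T$ are extended balanced $(\xi,\rho)$-HSS matrices (with respect to $l$ stages of balanced merging), where the positive integer $\rho$ and the value $\xi$ are linked by the bound $$\xi\le\frac{\theta^\rho}{(1-\theta)\,\delta},\qquad \theta=\frac{2\sin\left(\frac{\pi}{2k}\right)}{\sin\left(\frac{3\pi}{k}\right)},\qquad \delta\ge\delta_-=\sin\left(\frac{3\pi}{k}\right),$$ so that $\theta\approx 1/3$ and $\delta_-\approx 3\pi/k$ for large integers $k$. Here $\delta=\delta^{(h)}$ is the minimum distance, after the $h$-th merging, from the arc midpoints $c_q$ to the knots $s_i$ defining the rows of the corresponding admissible blocks.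
   Context: Uniform $k$-partition. Put $\phi_q=2\pi q/k$ and partition $\mathbb C$ into $k$ congruent semi-open sectors with vertex $0$, $\Gamma_q=\{r\exp(\psi\sqrt{-1}): r\ge0,\ \phi_q\le\psi<\phi_{q+1}\}$, $q=0,\dots,k-1$ (indices modulo $k$, angles modulo $2\pi$), and the unit circle into the arcs $\mathcal A_q=\Gamma_q\cap\{|z|=1\}$ with midpoints $c_q$. The knots $s_i$ and $t_j$ are enumerated in counter-clockwise order of their arguments, and $C=(C_{p,q})_{p,q=0}^{k-1}$ with $C_{p,q}=\left(\frac1{s_i-t_j}\right)_{s_i\in\Gamma_p,\,t_j\in\Gamma_q}$. The diagonal block is $\Sigma_q=C_{q,q}$; the tridiagonal block $\Sigma_q^{(c)}$ consists of $C_{q-1\bmod k,q}$, $C_{q,q}$, $C_{q+1\bmod k,q}$; the admissible block $N_q^{(c)}$ is the complement of $\Sigma_q^{(c)}$ in the block column $C_q$, i.e. it is defined by the knots $t_j\in\mathcal A_q$ and the knots $s_i$ outside $\Gamma_{q-1}\cup\Gamma_q\cup\Gamma_{q+1}$. Balanced merging. In each of the $l$ stages consecutive diagonal blocks (equivalently, adjacent sectors) are merged pairwise, so that after the $h$-th stage there are $k/2^h$ sectors of angle $2^{h+1}\pi/k$; the arcs, midpoints, tridiagonal blocks and admissible blocks are those of the merged partition. $(\xi,\rho)$-HSS. The $\xi$-rank of a matrix $M$ is $\min_{\|\tilde M-M\|\le\xi\|M\|}\operatorname{rank}(\tilde M)$, with $\|\cdot\|$ the spectral norm. $C$ is an extended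 balanced $(\xi,\rho)$-HSS matrix if all admissible blocks arising throughout the balanced merging have $\xi$-rank at most $\rho$. For $C^T$ the roles of rows and columns are interchanged. *)

(* Defs.v *)
From HB Require Import structures.
From mathcomp Require Import all_boot all_order all_algebra.
From mathcomp Require Import all_classical all_reals all_analysis.
From mathcomp Require Export complex.

Set Implicit Arguments.
Unset Strict Implicit.
Unset Printing Implicit Defensive.

Import Order.TTheory GRing.Theory Num.Theory.
Import numFieldNormedType.Exports.

Local Open Scope classical_set_scope.
Local Open Scope ring_scope.
Local Open Scope complex_scope.

Section SpectralNorm.
Variable R : realType.

Definition vnorm2 n (x : 'cV[R[i]]_n) : R :=
  Num.sqrt (\sum_(i < n) Normc.normc (x i 0) ^+ 2).

Definition spectral_norm m n (M : 'M[R[i]]_(m, n)) : R :=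
  sup [set vnorm2 (M *m x) | x in [set x : 'cV[R[i]]_n | vnorm2 x <= 1]].

(* For xi < 0 there may be no admissible N; the value is then m, which is why
   uses of xi_rank carry the hypothesis 0 <= xi. *)
Definition xi_rank m n (xi : R) (M : 'M[R[i]]_(m, n)) : nat :=
  \big[minn/m]_(r < m.+1 | `[< exists N : 'M[R[i]]_(m, n),
      spectral_norm (N - M) <= xi * spectral_norm M /\ \rank N = r >]) r.

Lemma spectral_norm0 m n : spectral_norm (0 : 'M[R[i]]_(m, n)) = 0.
Proof.
have v0 p : vnorm2 (0 : 'cV[R[i]]_p) = 0.
  rewrite /vnorm2 big1 ?sqrtr0 // => i _.
  by rewrite mxE Normc.normc0 expr0n.
rewrite /spectral_norm [X in sup X](_ : _ = [set 0]) ?sup1 //.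
apply/seteqP; split=> [_ [x _ <-]|_ ->] /=; first by rewrite mul0mx v0.
by exists 0; rewrite ?mulmx0 v0.
Qed.

Lemma xi_rank_leP m n (xi : R) (M : 'M[R[i]]_(m, n)) (rho : nat) :
  0 <= xi * spectral_norm M ->
  (xi_rank xi M <= rho)%N <-> exists N : 'M[R[i]]_(m, n),
    spectral_norm (N - M) <= xi * spectral_norm M /\ (\rank N <= rho)%N.
Proof.
move=> xi0; split; last first.
  move=> [N [NM Nr]]; apply: leq_trans Nr.
  have Nm : (\rank N < m.+1)%N by rewrite ltnS rank_leq_row.
  rewrite /xi_rank -[X in (_ <= X)%N]/(nat_of_ord (Ordinal Nm)).
  apply: (@bigmin_le_cond _ nat _ m (Ordinal Nm) _ (@nat_of_ord m.+1)).
  by apply/asboolP; exists N.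
have [r -> [N [NM Nr]]] : exists2 r, xi_rank xi M = r &
    exists N : 'M[R[i]]_(m, n),
      spectral_norm (N - M) <= xi * spectral_norm M /\ (\rank N <= r)%N.
  exists (xi_rank xi M) => //; rewrite /xi_rank.
  elim/big_ind: _ => [|x y IHx IHy|r /asboolP[N [NM <-]]].
  - by exists M; rewrite subrr spectral_norm0 rank_leq_row.
  - by rewrite /minn; case: ifP.
  - by exists N.
by move=> rho_r; exists N; split=> //; apply: leq_trans rho_r.
Qed.

End SpectralNorm.

Section Sectors.
Variable R : realType.

Definition cis (psi : R) : R[i] := cos psi +i* sin psi.

(* The vertex 0 lies on the boundary of every sector; it is attributed to the
   sector of index 0, so that the sectors form a partition of the plane. *)
Definition sector (k q : nat) : set R[i] :=
  [set z | (exists r psi : R, [/\ 0 <= r,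
              2 * pi * q%:R / k%:R <= psi < 2 * pi * q.+1%:R / k%:R
            & z = r%:C * cis psi])
           /\ (z = 0 -> q = 0%N)].

Definition merge_pairs (G : nat -> set R[i]) (q : nat) : set R[i] :=
  G q.*2 `|` G q.*2.+1.

Definition num_sectors (k h : nat) : nat := k %/ 2 ^ h.

Definition merged_sector (k h : nat) : nat -> set R[i] :=
  iter h merge_pairs (sector k).

Definition arc (k h q : nat) : set R[i] :=
  merged_sector k h q `&` [set z | Normc.normc z = 1].

(* After h merging stages the q-th arc is
   { cis psi | 2 pi q / K <= psi < 2 pi (q + 1) / K } with K = k / 2 ^ h. *)
Definition arc_midpoint (k h q : nat) : R[i] :=
  cis (pi * q.*2.+1%:R / (num_sectors k h)%:R).

(* K + q - 1 stands for q - 1 modulo K, since nat subtraction truncates. *)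
Definition neighbourhood (k h q : nat) : set R[i] :=
  let K := num_sectors k h in
  merged_sector k h ((K + q - 1) %% K)%N `|` merged_sector k h q
    `|` merged_sector k h (q.+1 %% K)%N.

End Sectors.

Section CV.
Variable R : realType.
Implicit Types (m n k h q : nat).

Definition cauchy_mx m n (s : 'I_m -> R[i]) (t : 'I_n -> R[i]) :
  'M[R[i]]_(m, n) := \matrix_(i, j) (s i - t j)^-1.

Definition cv_knot n (f : R[i]) (j : 'I_n) : R[i] :=
  f * cis (2 * pi * j%:R / n%:R).

Definition admissible_s m (s : 'I_m -> R[i]) k h q : {set 'I_m} :=
  [set i | `[< ~ neighbourhood k h q (s i) >]].

Definition admissible_t n (t : 'I_n -> R[i]) k h q : {set 'I_n} :=
  [set j | `[< arc k h q (t j) >]].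

Definition block m n (A : 'M[R[i]]_(m, n)) (I : {set 'I_m}) (J : {set 'I_n}) :
  'M[R[i]]_(#|I|, #|J|) := mxsub enum_val enum_val A.

(* The index sets rows h q and cols h q delimit the q-th admissible block after
   h merging stages. *)
Definition stage_xi_rank_le m n (A : 'M[R[i]]_(m, n))
    (rows : nat -> nat -> {set 'I_m}) (cols : nat -> nat -> {set 'I_n})
    (k h : nat) (xi : R) (rho : nat) : Prop :=
  forall q, (q < num_sectors k h)%N ->
    (xi_rank xi (block A (rows h q) (cols h q)) <= rho)%N.

Definition extended_balanced_HSS m n (A : 'M[R[i]]_(m, n))
    (rows : nat -> nat -> {set 'I_m}) (cols : nat -> nat -> {set 'I_n})
    (k l : nat) (xi : R) (rho : nat) : Prop :=
  forall h, (h <= l)%N -> stage_xi_rank_le A rows cols k h xi rho.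

Definition theta k : R :=
  2 * sin (pi / (2 * k%:R)) / sin (3 * pi / k%:R).

Definition delta_minus k : R := sin (3 * pi / k%:R).

(* A minimum: the set is finite, and nonempty as soon as m > 0 and there are
   more than three sectors. *)
Definition delta m (s : 'I_m -> R[i]) k h : R :=
  inf [set d | exists q i, [/\ (q < num_sectors k h)%N,
                 i \in admissible_s s k h q
               & d = Normc.normc (s i - arc_midpoint R k h q)]].

Definition xi_bound (theta delta : R) (rho : nat) : R :=
  theta ^+ rho / ((1 - theta) * delta).

End CV.

(* Main.v *)
(** After [h] merging stages the partition is the uniform one into [K = k / 2 ^ h]
sectors, and [K] is a power of two that is at least 8. For an admissible block with
arc midpoint [c], rotated to [c = 1], the knots [t] lie within angle [w = pi / K]
of 1, and the knots [s] at angle at least [3 w]. If [u, v] are scalar functions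
with [1 - u(s) v(t)] of the form [(s - t) a(s) b(t)], then truncating
[1 / (s - t) = a(s) b(t) sum_nu (u(s) v(t))^nu] after [rho] terms leaves the error
[(u(s) v(t))^rho / (s - t)], a two-sided diagonal rescaling of the block, so the
relative error in spectral norm is at most [(max |u| max |v|)^rho].

For merged stages the Taylor expansion, [u = 1 / (s - 1)] and [v = t - 1], has a
ratio that may exceed [theta k]. When [delta <= 3/2] one takes instead the
Cayley transform, [u = (s + 1) / (s - 1)] and [v = (t - 1) / (t + 1)], whose ratio
[tan (w / 2) / tan (3 w / 2)] is below [1/3 <= theta k] for every [K]; the factor
[1 / ((1 - theta) delta)] is then at least 1. When [delta > 3/2] the Taylor
expansion has ratio at most [1 / (2 delta)], and one of its [rho] factors
absorbs [1 / ((1 - theta) delta)]. *)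

Require Import Defs.
From mathcomp Require Import all_boot all_order all_algebra.
From mathcomp Require Import all_classical all_reals all_analysis.
From mathcomp Require Import ring lra.

Import Order.TTheory GRing.Theory Num.Theory.
Import numFieldNormedType.Exports.

Local Open Scope classical_set_scope.
Local Open Scope ring_scope.
Local Open Scope complex_scope.

Set Implicit Arguments.
Unset Strict Implicit.
Unset Printing Implicit Defensive.

(** * Spectral norm and displacement *)

Section Spectral.
Variable R : realType.
Implicit Types z : R[i].

Local Notation normc := (@Normc.normc R).

Lemma normc_ge0 z : 0 <= normc z.
Proof. by case: z => a b; exact: sqrtr_ge0. Qed.

Lemma normc_gt0 z : z != 0 -> 0 < normc z.
Proof.
by move=> z0; rewrite lt_def normc_ge0 andbT; apply: contra z0 => /eqP/Normc.eq0_normc->.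
Qed.

Lemma normcX z p : normc (z ^+ p) = normc z ^+ p.
Proof.
elim: p => [|p IH]; first by rewrite !expr0 Normc.normc1.
by rewrite !exprS Normc.normcM IH.
Qed.

Lemma normc_sum (I : finType) (F : I -> R[i]) :
  normc (\sum_i F i) <= \sum_i normc (F i).
Proof.
elim/big_ind2: _ => [|x a y b xa yb|//]; first by rewrite Normc.normc0.
by apply: le_trans (lerD xa yb); exact: le_normcD.
Qed.

Lemma vnorm2_ge0 n (x : 'cV[R[i]]_n) : 0 <= vnorm2 x.
Proof. exact: sqrtr_ge0. Qed.

Lemma vnorm2Z n c (x : 'cV[R[i]]_n) : vnorm2 (c *: x) = normc c * vnorm2 x.
Proof.
rewrite /vnorm2 -[normc c]ger0_norm ?normc_ge0// -sqrtr_sqr -sqrtrM ?sqr_ge0//.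
by rewrite mulr_sumr; congr Num.sqrt; apply: eq_bigr => i _;
  rewrite mxE Normc.normcM exprMn.
Qed.

Lemma vnorm20 n : vnorm2 (0 : 'cV[R[i]]_n) = 0.
Proof. by rewrite -(scale0r 0) vnorm2Z Normc.normc0 mul0r. Qed.

Lemma vnorm2_eq0 n (x : 'cV[R[i]]_n) : vnorm2 x = 0 -> x = 0.
Proof.
move/eqP; rewrite sqrtr_eq0 => x0.
have /eqP : \sum_(i < n) normc (x i 0) ^+ 2 = 0.
  by apply/eqP; rewrite eq_le x0 sumr_ge0// => i _; rewrite sqr_ge0.
rewrite psumr_eq0 => [/allP xi0|i _]; last exact: sqr_ge0.
apply/matrixP => i j; rewrite ord1 mxE; apply: Normc.eq0_normc.
by apply/eqP; rewrite -sqrf_eq0; have := xi0 i (mem_index_enum i).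
Qed.

Lemma vnorm2_le_scale n (D : R) (d : 'I_n -> R[i]) (x y : 'cV[R[i]]_n) :
  (forall i, normc (d i) <= D) -> 0 <= D -> (forall i, y i 0 = d i * x i 0) ->
  vnorm2 y <= D * vnorm2 x.
Proof.
move=> dD D0 yE; rewrite /vnorm2 -[D]ger0_norm// -sqrtr_sqr -sqrtrM ?sqr_ge0//.
rewrite ler_wsqrtr// mulr_sumr; apply: ler_sum => i _.
rewrite yE Normc.normcM exprMn ler_wpM2r ?sqr_ge0//.
by rewrite lerXn2r ?nnegrE ?normc_ge0.
Qed.

(** A supremum is informative only for a bounded set. Entries of a vector of norm at most 1 have
    modulus at most 1, so each entry of [M *m x] is bounded by the sum of the moduli in its row. *)
Lemma has_ubound_spectral m n (M : 'M[R[i]]_(m, n)) :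
  has_ubound [set vnorm2 (M *m x) | x in [set x : 'cV[R[i]]_n | vnorm2 x <= 1]].
Proof.
exists (Num.sqrt (\sum_i (\sum_j normc (M i j)) ^+ 2)) => _ [x x1 <-].
rewrite ler_wsqrtr//; apply: ler_sum => i _.
rewrite lerXn2r ?nnegrE ?normc_ge0 ?sumr_ge0//; first by move=> j _; exact: normc_ge0.
rewrite mxE; apply: le_trans (normc_sum _) _; apply: ler_sum => j _.
rewrite Normc.normcM -[leRHS]mulr1 ler_wpM2l ?normc_ge0//.
apply: le_trans x1; rewrite -[normc _]ger0_norm ?normc_ge0// -sqrtr_sqr ler_wsqrtr//.
by rewrite (bigD1 j)//= lerDl sumr_ge0// => k _; rewrite sqr_ge0.
Qed.

Lemma vnorm2_mulmx_le_spectral m n (M : 'M[R[i]]_(m, n)) (x : 'cV[R[i]]_n) :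
  vnorm2 x <= 1 -> vnorm2 (M *m x) <= spectral_norm M.
Proof.
move=> x1; apply: sup_upper_bound; last by exists x.
split; last exact: has_ubound_spectral.
by exists (vnorm2 (M *m x)), x.
Qed.

Lemma spectral_norm_ge0 m n (M : 'M[R[i]]_(m, n)) : 0 <= spectral_norm M.
Proof.
apply: le_trans (vnorm2_ge0 (M *m 0)) _.
by apply: vnorm2_mulmx_le_spectral; rewrite vnorm20.
Qed.

Lemma vnorm2_mulmx_le m n (M : 'M[R[i]]_(m, n)) (x : 'cV[R[i]]_n) :
  vnorm2 (M *m x) <= spectral_norm M * vnorm2 x.
Proof.
have [x0|x0] := eqVneq (vnorm2 x) 0.
  by rewrite x0 (vnorm2_eq0 x0) mulmx0 vnorm20 mulr0.
have xp : 0 < vnorm2 x by rewrite lt_def x0 vnorm2_ge0.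
have nV : normc ((vnorm2 x)^-1)%:C = (vnorm2 x)^-1.
  by rewrite /Normc.normc /= expr0n addr0 sqrtr_sqr gtr0_norm// invr_gt0.
rewrite -ler_pdivrMr// mulrC -nV -vnorm2Z scalemxAr.
by apply: vnorm2_mulmx_le_spectral; rewrite vnorm2Z nV mulVf.
Qed.

Lemma spectral_norm_scale m n (M E : 'M[R[i]]_(m, n)) (c d : R)
    (a : 'I_m -> R[i]) (b : 'I_n -> R[i]) :
  0 <= c -> 0 <= d ->
  (forall i, normc (a i) <= c) -> (forall j, normc (b j) <= d) ->
  (forall i j, E i j = a i * b j * M i j) ->
  spectral_norm E <= c * d * spectral_norm M.
Proof.
move=> c0 d0 ac bd EE; apply: ge_sup.
  by exists (vnorm2 (E *m 0)), 0 => //=; rewrite vnorm20.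
move=> _ [x /= x1 <-].
pose y : 'cV[R[i]]_n := \col_j (b j * x j 0).
have Ex i : (E *m x) i 0 = a i * (M *m y) i 0.
  rewrite !mxE mulr_sumr; apply: eq_bigr => j _; rewrite EE mxE; ring.
apply: le_trans (vnorm2_le_scale ac c0 Ex) _.
rewrite -mulrA ler_wpM2l// (le_trans (vnorm2_mulmx_le _ _))// mulrC.
rewrite ler_wpM2r ?spectral_norm_ge0//.
have yE j : y j 0 = b j * x j 0 by rewrite mxE.
by apply: le_trans (vnorm2_le_scale bd d0 yE) _; rewrite -[leRHS]mulr1 ler_wpM2l.
Qed.

(* [M] has displacement rank one: the truncated geometric series
   [N i j = sum_(nu < rho) a_i b_j (u_i v_j)^nu] equals [(1 - (u_i v_j)^rho) M i j],
   so that the error is a diagonal rescaling of [M] itself. *)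
Lemma xi_rank_displacement m n (M : 'M[R[i]]_(m, n)) (u a : 'I_m -> R[i])
    (v b : 'I_n -> R[i]) (U V xi : R) (rho : nat) :
  0 <= U -> 0 <= V -> (U * V) ^+ rho <= xi ->
  (forall i, normc (u i) <= U) -> (forall j, normc (v j) <= V) ->
  (forall i j, (1 - u i * v j) * M i j = a i * b j) ->
  (xi_rank xi M <= rho)%N.
Proof.
move=> U0 V0 UVxi uU vV ME.
have xi0 : 0 <= xi by apply: le_trans UVxi; rewrite exprn_ge0 ?mulr_ge0.
apply/xi_rank_leP; first by rewrite mulr_ge0 ?spectral_norm_ge0.
pose A : 'M[R[i]]_(m, rho) := \matrix_(i, nu) (a i * u i ^+ nu).
pose B : 'M[R[i]]_(rho, n) := \matrix_(nu, j) (b j * v j ^+ nu).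
exists (A *m B); split; last first.
  exact: leq_trans (mulmx_max_rank _ _) (leqnn _).
apply: (@le_trans _ _ (U ^+ rho * V ^+ rho * spectral_norm M)).
  apply: (@spectral_norm_scale _ _ M _ _ _ (fun i => - u i ^+ rho)
    (fun j => v j ^+ rho)) => [||i|j|i j].
  - exact: exprn_ge0.
  - exact: exprn_ge0.
  - by rewrite normcN normcX lerXn2r ?nnegrE ?normc_ge0.
  - by rewrite normcX lerXn2r ?nnegrE ?normc_ge0.
  have -> : (A *m B - M) i j =
      (\sum_(nu < rho) (u i * v j) ^+ nu) * (a i * b j) - M i j.
    rewrite !mxE mulr_suml; congr (_ - _); apply: eq_bigr => nu _.
    by rewrite !mxE exprMn; ring.
  (* With [x = u i * v j], the series times [1 - x] telescopes to [1 - x ^+ rho]; the error is thus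
     [- x ^+ rho * M i j]. *)
  have := subrX1 (u i * v j) rho; rewrite -ME exprMn => h.
  have -> : (\sum_(nu < rho) (u i * v j) ^+ nu) * ((1 - u i * v j) * M i j) =
     - ((u i * v j - 1) * (\sum_(nu < rho) (u i * v j) ^+ nu)) * M i j by ring.
  rewrite -h; ring.
by rewrite -exprMn ler_wpM2r ?spectral_norm_ge0.
Qed.

(** The displacement identity is symmetric under exchanging [(u, a)] with [(v, b)], so one expansion
    serves both [M] and its transpose. *)
Lemma xi_rank_displacement_tr m n (M : 'M[R[i]]_(m, n)) (u a : 'I_m -> R[i])
    (v b : 'I_n -> R[i]) (U V xi : R) (rho : nat) :
  0 <= U -> 0 <= V -> (U * V) ^+ rho <= xi ->
  (forall i, normc (u i) <= U) -> (forall j, normc (v j) <= V) ->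
  (forall i j, (1 - u i * v j) * M i j = a i * b j) ->
  (xi_rank xi M <= rho)%N /\ (xi_rank xi M^T <= rho)%N.
Proof.
move=> U0 V0 UV uU vV ME; split; first exact: (@xi_rank_displacement _ _ M u a v b U V).
apply: (@xi_rank_displacement _ _ _ v b u a V U) => // [|j i].
  by rewrite mulrC.
by rewrite mxE [v j * _]mulrC ME mulrC.
Qed.

End Spectral.

(** * Sectors and their neighbourhoods *)

Section Geometry.
Variable R : realType.
Implicit Types (z w : R[i]) (x psi : R).

Local Notation normc := (@Normc.normc R).
Local Notation cis := (@cis R).
Local Notation Re := (@complex.Re R).
Local Notation Im := (@complex.Im R).

Lemma sq_normc z : normc z ^+ 2 = Re z ^+ 2 + Im z ^+ 2.
Proof. by case: z => x y; rewrite /= sqr_sqrtr// addr_ge0 ?sqr_ge0. Qed.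

Lemma le_cos_norm x y : `|x| <= y -> y <= pi -> cos y <= cos x.
Proof.
move=> xy ypi; rewrite -(cos_norm x) leNgt.
rewrite ltr_cos ?in_itv/= ?normr_ge0 ?ypi ?(le_trans (normr_ge0 _) xy)//.
  by rewrite -leNgt.
exact: le_trans ypi.
Qed.

Lemma normc_cis psi : normc (cis psi) = 1.
Proof. by rewrite /Normc.normc /= cos2Dsin2 sqrtr1. Qed.

Lemma cisD x y : cis (x + y) = cis x * cis y.
Proof. by apply/eqP; rewrite eq_complex /= cosD sinD; apply/andP; split; apply/eqP; ring. Qed.

Lemma cis0 : cis 0 = 1.
Proof. by rewrite /Defs.cis cos0 sin0. Qed.

Lemma cisDnpi psi p : cis (psi + 2 * pi * p%:R) = cis psi.
Proof.
have -> : psi + 2 * pi * p%:R = psi + (pi *+ 2) *+ p.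
  by rewrite -mulrnA -[(pi *+ (2 * p))]mulr_natl natrM; ring.
by rewrite /Defs.cis (periodicn (@cosD2pi R)) (periodicn (@sinD2pi R)).
Qed.

(** [acos] of the normalised real part gives the angle up to sign; the sign of the imaginary part
    decides. *)
Lemma polar z : exists2 psi, `|psi| <= pi & z = (normc z)%:C * cis psi.
Proof.
have [->|z0] := eqVneq z 0.
  by exists 0; rewrite ?normr0 ?pi_ge0// Normc.normc0 mul0r.
have r0 := normc_gt0 z0.
have := sq_normc z; case: z r0 {z0} => a b; set r := normc _ => r0 /= rE.
have ar : -1 <= a / r <= 1.
  rewrite -ler_norml -(@expr_le1 _ 2)// real_normK ?num_real// expr_div_n ler_pdivrMr ?exprn_gt0//.
  by rewrite mul1r rE lerDl sqr_ge0.
have sE : sin (acos (a / r)) = `|b| / r.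
  rewrite sin_acos// -[RHS]ger0_norm; last by rewrite divr_ge0 ?(ltW r0).
  rewrite -sqrtr_sqr; congr Num.sqrt; rewrite !expr_div_n real_normK ?num_real//.
  apply: (mulIf (expf_neq0 2 (lt0r_neq0 r0))).
  by rewrite mulrBl !divfK ?mul1r ?expf_neq0 ?lt0r_neq0// rE addrAC subrr add0r.
have aE : cos (acos (a / r)) = a / r by rewrite acosK.
exists (if 0 <= b then acos (a / r) else - acos (a / r)).
  by case: ifP => _; rewrite ?normrN ger0_norm ?acos_ge0 ?acos_lepi.
apply/eqP; rewrite eq_complex /= !mul0r !subr0 !addr0; apply/andP; split.
  by rewrite fun_if cosN if_same aE mulrCA divff ?mulr1 ?lt0r_neq0.
case: ifP => b0; rewrite ?sinN sE mulrC ?mulNr divfK ?lt0r_neq0//.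
  by rewrite ger0_norm.
by rewrite ltr0_norm ?opprK// ltNge b0.
Qed.

Lemma Re_polar r psi phi : Re (r%:C * cis psi * cis (- phi)) = r * cos (psi - phi).
Proof. by rewrite -mulrA -cisD /= mul0r subr0. Qed.

Lemma merge_sector K : (0 < K)%N -> merge_pairs (@sector R (2 * K)) = @sector R K.
Proof.
move=> K0; have K0' : (K%:R : R) != 0 by rewrite pnatr_eq0 -lt0n.
have half q : 2 * pi * (q.*2)%:R / (2 * K)%:R = 2 * pi * q%:R / K%:R :> R.
  by rewrite -muln2 !natrM; field.
apply/funext => q; apply/seteqP; split => z.
  case=> -[[r [psi [r0 /andP[lpsi psiu] zE]]] z0].
    split=> [|/z0/eqP]; last by rewrite double_eq0 => /eqP.
    exists r, psi; split=> //; rewrite -!half lpsi (lt_le_trans psiu)//.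
    by rewrite ler_pM2r ?invr_gt0 ?ltr0n ?muln_gt0// ler_pM2l ?ler_nat ?doubleS// mulr_gt0 ?pi_gt0.
  split=> [|/z0//]; exists r, psi; split=> //.
  rewrite -!half doubleS psiu andbT (le_trans _ lpsi)//.
  by rewrite ler_pM2r ?invr_gt0 ?ltr0n ?muln_gt0// ler_pM2l ?ler_nat// mulr_gt0 ?pi_gt0.
move=> [[r [psi [r0 /andP[lpsi psiu] zE]]] z0].
(* The vertex belongs to sector 0 only, hence to its first half; the starting ray of that half
   supplies an angle. *)
have [z00|z00] := eqVneq z 0.
  left; split; last by move=> /z0 ->.
  exists 0, (2 * pi * q.*2%:R / (2 * K)%:R); rewrite z00 mul0r lexx; split=> //=.
  by rewrite ltr_pM2r ?invr_gt0 ?ltr0n ?muln_gt0// ltr_pM2l ?ltr_nat// mulr_gt0 ?pi_gt0.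
have [lt|ge] := ltP psi (2 * pi * q.*2.+1%:R / (2 * K)%:R).
  left; split; last by move/eqP: z00.
  by exists r, psi; rewrite half lpsi lt.
right; split; last by move/eqP: z00.
by exists r, psi; rewrite ge -doubleS half psiu.
Qed.

Lemma merged_sectorE l h : (h <= l)%N ->
  @merged_sector R (2 ^ l) h = @sector R (num_sectors (2 ^ l) h).
Proof.
elim: h => [|h IH] hl; first by rewrite /merged_sector/num_sectors expn0 divn1.
rewrite /merged_sector iterS -/(@merged_sector R _ h) IH ?(ltnW hl)// /num_sectors.
rewrite -!expnB ?(ltnW hl)// -subSS subSn// expnS merge_sector// expn_gt0//.
Qed.

(** The index stays unreduced so that the angles of cyclically adjacent sectors follow each other
    without a jump; [p %/ K] full turns are subtracted. The vertex is excluded because it lies in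
    sector 0 alone. *)
Lemma sector_modI K p z psi : (0 < K)%N -> z != 0 ->
  2 * pi * p%:R / K%:R <= psi < 2 * pi * p.+1%:R / K%:R ->
  z = (normc z)%:C * cis psi -> @sector R K (p %% K) z.
Proof.
move=> K0 z0 /andP[lpsi psiu] zE; split; last by move/eqP: z0.
have K0' : (K%:R : R) != 0 by rewrite pnatr_eq0 -lt0n.
have shift q : 2 * pi * (q + p %/ K * K)%:R / K%:R =
    2 * pi * q%:R / K%:R + 2 * pi * (p %/ K)%:R :> R.
  by rewrite natrD natrM; field.
exists (normc z), (psi - 2 * pi * (p %/ K)%:R); split; first exact: normc_ge0.
  rewrite lerBrDr ltrBlDr -!shift addSn addnC -divn_eq.
  by rewrite lpsi psiu.
by rewrite {1}zE -[in RHS](cisDnpi _ (p %/ K)) subrK.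
Qed.

Lemma sector_modE K p z : (0 < K)%N -> @sector R K (p %% K) z ->
  exists2 psi, 2 * pi * p%:R / K%:R <= psi < 2 * pi * p.+1%:R / K%:R &
  z = (normc z)%:C * cis psi.
Proof.
move=> K0 [[r [psi [r0 /andP[lpsi psiu] zE]]] _].
have K0' : (K%:R : R) != 0 by rewrite pnatr_eq0 -lt0n.
have shift q : 2 * pi * (q + p %/ K * K)%:R / K%:R =
    2 * pi * q%:R / K%:R + 2 * pi * (p %/ K)%:R :> R.
  by rewrite natrD natrM; field.
exists (psi + 2 * pi * (p %/ K)%:R).
  have pE : p = (p %% K + p %/ K * K)%N by rewrite addnC -divn_eq.
  by rewrite {1 4}pE -addSn !shift lerD2r ltrD2r lpsi psiu.
rewrite cisDnpi {1}zE; congr (_%:C * _).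
by rewrite zE Normc.normcM normc_cis mulr1 /= expr0n addr0 sqrtr_sqr ger0_norm.
Qed.

End Geometry.

(** * Distances and real parts after rotating an arc midpoint to 1 *)

Section Neighbourhoods.
Variable R : realType.
Implicit Types (z : R[i]) (C : R).

Local Notation normc := (@Normc.normc R).
Local Notation cis := (@cis R).
Local Notation Re := (@complex.Re R).

Lemma sq_normcB1 z : normc (z - 1) ^+ 2 = normc z ^+ 2 - 2 * Re z + 1.
Proof. by rewrite !sq_normc; case: z => x y /=; rewrite subr0; ring. Qed.

Lemma sq_normcD1 z : normc (z + 1) ^+ 2 = normc z ^+ 2 + 2 * Re z + 1.
Proof. by rewrite !sq_normc; case: z => x y /=; rewrite addr0; ring. Qed.

(** Completing the square in [normc z]. With [C = cos alpha], it keeps points at angle at least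
    [alpha] from 1 at distance at least [sin alpha] from 1. *)
Lemma sq_normcB1_ge z C : Re z <= normc z * C -> 1 - C ^+ 2 <= normc (z - 1) ^+ 2.
Proof.
move=> zC; rewrite sq_normcB1.
have := sqr_ge0 (normc z - C); rewrite sqrrB; lra.
Qed.

(** The difference of the two sides is at least [2 * C * (normc z - 1) ^+ 2]. This bounds the Cayley
    factor [(z + 1) / (z - 1)]. *)
Lemma sq_normcD1_le z C : 0 <= C -> Re z <= normc z * C ->
  normc (z + 1) ^+ 2 * (1 - C) <= normc (z - 1) ^+ 2 * (1 + C).
Proof.
move=> C0 zC; rewrite sq_normcB1 sq_normcD1.
have := mulr_ge0 C0 (sqr_ge0 (normc z - 1)); rewrite sqrrB; lra.
Qed.

Lemma normcB_cis z psi : normc (z * cis (- psi) - 1) = normc (z - cis psi).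
Proof.
rewrite -[RHS]mulr1 -(normc_cis (- psi)) -Normc.normcM mulrBl -cisD.
by rewrite subrr cis0.
Qed.

Variables (l h : nat).
Hypothesis hl : (h <= l)%N.
Let K := num_sectors (2 ^ l) h.

Lemma num_sectorsE : K = (2 ^ (l - h))%N.
Proof. by rewrite expnB. Qed.

Let K_gt0 : (0 < K)%N. Proof. by rewrite num_sectorsE expn_gt0. Qed.
Let KR_neq0 : (K%:R : R) != 0. Proof. by rewrite pnatr_eq0 -lt0n. Qed.

Lemma neighbourhoodE q : neighbourhood (2 ^ l) h q =
  @sector R K ((K + q - 1) %% K) `|` @sector R K q `|` @sector R K (q.+1 %% K).
Proof. by rewrite /neighbourhood !merged_sectorE. Qed.

(** Three adjacent sectors cover every angle within [3 * pi / K] of the midpoint, so a point outside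
    them has a larger angle [beta], and cosine decreases on [[0, pi]]. *)
Lemma Re_not_neighbourhood q z : (3 <= K)%N -> (q < K)%N ->
  ~ neighbourhood (2 ^ l) h q z ->
  Re (z * cis (- (pi * q.*2.+1%:R / K%:R))) <= normc z * cos (3 * pi / K%:R).
Proof.
move=> K3 qK; rewrite neighbourhoodE => zN.
have [->|z0] := eqVneq z 0; first by rewrite mul0r Normc.normc0 mul0r.
set gamma := pi * _ / _; pose w : R := pi / K%:R.
have [beta betapi zE] := polar (z * cis (- gamma)).
have nE : normc (z * cis (- gamma)) = normc z by rewrite Normc.normcM normc_cis mulr1.
rewrite nE in zE; rewrite zE /= mul0r subr0 ler_wpM2l ?normc_ge0//.
rewrite -[in leLHS]cos_norm.
have [le3|] := leP (3 * pi / K%:R) `|beta|.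
  apply: le_cos_norm => //; rewrite ger0_norm//.
  by rewrite divr_ge0 ?mulr_ge0 ?pi_ge0 ?ler0n.
rewrite ltr_norml => /andP[lbeta betau]; exfalso; apply: zN.
(* One full turn is added so that the relevant indices are [K + q - 1], [K + q] and [K + q + 1],
   where no subtraction truncates. *)
pose psi := beta + gamma + 2 * pi * 1%:R.
have zpsi : z = (normc z)%:C * cis psi.
  by rewrite cisDnpi cisD mulrA -zE -mulrA -cisD addNr cis0 mulr1.
have scale p : 2 * pi * p / K%:R = 2 * w * p by rewrite /w; ring.
have psiE : psi = beta + w * (2 * q%:R + 1) + 2 * w * K%:R.
  by rewrite /psi /gamma /w -muln2 -addn1 natrD natrM; field.
have sectorI p : 2 * w * p%:R <= psi -> psi < 2 * w * p.+1%:R ->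
    sector K (p %% K) z.
  by move=> le lt; apply: sector_modI zpsi => //; rewrite !scale le.
have qE : q = ((K + q) %% K)%N by rewrite modnDl modn_small.
have q1E : (q.+1 %% K = (K + q).+1 %% K)%N by rewrite -addnS modnDl.
have predK : (K + q - 1).+1 = (K + q)%N by rewrite subn1 prednK// addn_gt0 K_gt0.
have lbeta' : - (3 * w) < beta by rewrite /w mulrA.
have betau' : beta < 3 * w by rewrite /w mulrA.
have [lt1|ge1] := ltP psi (2 * w * (K + q)%:R).
  left; left; apply: sectorI; last by rewrite predK.
  by rewrite psiE natrB ?addn_gt0 ?K_gt0// natrD; lra.
have [lt2|ge2] := ltP psi (2 * w * (K + q).+1%:R).
  by left; right; rewrite qE; apply: sectorI.
right; rewrite q1E; apply: sectorI => //.
by rewrite psiE (natrD _ 2 (K + q)%N) natrD; lra.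
Qed.

(** The half-opening [3 * pi / K] is below [pi / 2]. Used to separate the neighbourhoods of opposite
    sectors. *)
Lemma Re_neighbourhood q z : (7 <= K)%N -> (q < K)%N -> z != 0 ->
  neighbourhood (2 ^ l) h q z ->
  0 < Re (z * cis (- (pi * q.*2.+1%:R / K%:R))).
Proof.
move=> K7 qK z0; rewrite neighbourhoodE => zN.
set gamma := pi * _ / _; pose w : R := pi / K%:R.
have z_gt0 := normc_gt0 z0.
have w0 : 0 < w by rewrite divr_gt0 ?pi_gt0 ?ltr0n.
have w7 : 7 * w <= pi.
  by rewrite mulrA ler_pdivrMr ?ltr0n// mulrC ler_wpM2l ?pi_ge0// ler_nat.
have scale p : 2 * pi * p / K%:R = 2 * w * p by rewrite /w; ring.
have gammaE : gamma = w * (2 * q%:R + 1).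
  by rewrite /gamma /w -muln2 -addn1 natrD natrM; field.
have wK : w * K%:R = pi by rewrite divfK.
have qE : q = ((K + q) %% K)%N by rewrite modnDl modn_small.
have q1E : (q.+1 %% K = (K + q).+1 %% K)%N by rewrite -addnS modnDl.
have predK : (K + q - 1).+1 = (K + q)%N by rewrite subn1 prednK// addn_gt0 K_gt0.
have predR : (K + q - 1)%:R = K%:R + q%:R - 1 :> R.
  by rewrite natrB ?addn_gt0 ?K_gt0// natrD.
have nS1 p : p.+1%:R = p%:R + 1 :> R by rewrite natr1.
have nS2 p : p.+2%:R = p%:R + 2 :> R by rewrite -natrD addn2.
have [psi psiI ->] : exists2 psi, 2 * w * (K%:R + q%:R - 1) <= psi <
    2 * w * (K%:R + q%:R + 2) & z = (normc z)%:C * cis psi.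
  case: zN => [[|]|]; [|rewrite {1}qE|rewrite q1E];
    move=> /(sector_modE K_gt0)[psi psiI zE]; exists psi => //; move: psiI;
    rewrite !scale ?predK ?predR ?nS1 ?nS2 ?natrD => /andP[le lt];
    apply/andP; split; lra.
(* [psi - gamma] lies near one full turn, which is split off. *)
rewrite Re_polar mulr_gt0// -[psi - gamma](subrK (2 * pi * 1%:R)).
have -> : 2 * pi * 1%:R = pi *+ 2 :> R by rewrite mulr1 mulr_natl.
rewrite cosD2pi cos_gt0_pihalf// gammaE -mulr_natl -wK.
move: psiI => /andP[le lt]; apply/andP; split; lra.
Qed.

Lemma arc_polar q z : (q < K)%N -> Defs.arc (2 ^ l) h q z ->
  normc z = 1 /\ cos (pi / K%:R) <= Re (z * cis (- (pi * q.*2.+1%:R / K%:R))).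
Proof.
move=> qK [/= zs z1]; split=> //; move: zs; rewrite merged_sectorE// -/K.
have {1}-> : q = (q %% K)%N by rewrite modn_small.
move=> /(sector_modE K_gt0)[psi /andP[le lt] ->].
rewrite Re_polar z1 mul1r; pose w : R := pi / K%:R.
have w0 : 0 < w by rewrite divr_gt0 ?pi_gt0 ?ltr0n.
have scale p : 2 * pi * p / K%:R = 2 * w * p by rewrite /w; ring.
have gammaE : pi * q.*2.+1%:R / K%:R = w * (2 * q%:R + 1) :> R.
  by rewrite /w -muln2 -addn1 natrD natrM; field.
rewrite gammaE -/w; rewrite !scale -addn1 natrD in le lt.
apply: le_cos_norm.
  by rewrite ler_norml; apply/andP; split; lra.
by rewrite ler_pdivrMr ?ltr0n// ler_peMr ?pi_ge0// ler1n.
Qed.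

(** The neighbourhoods of the opposite sectors 0 and [K./2] lie, apart from the vertex, in opposite
    open half-planes, so no nonzero point is in both. This makes the set defining [delta]
    nonempty. *)
Lemma exists_not_neighbourhood z : (8 <= K)%N ->
  exists2 q, (q < K)%N & ~ neighbourhood (2 ^ l) h q z.
Proof.
move=> K8; have KE : K = (K./2).*2.
  rewrite -[LHS]odd_double_half [odd _](_ : _ = false)// num_sectorsE oddX/= orbF.
  by apply/eqP => h0; move: K8; rewrite num_sectorsE h0 expn0.
have K7 : (7 <= K)%N by apply: leq_trans K8.
have h4 : (4 <= K./2)%N by rewrite -leq_double -KE.
have h1K : (K./2.+1 < K)%N.
  by rewrite [in X in (_ < X)%N]KE -addnn -addn1 ltn_add2l (leq_trans _ h4).
have halfK : (K./2 < K)%N by exact: ltnW h1K.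
(* The vertex counts as a point of sector 0, which is not among the three sectors around [K./2]. *)
have [-> {z}|z0] := eqVneq z 0.
  exists K./2 => //; rewrite neighbourhoodE => -[[|]|] -[_ /(_ erefl)].
  - rewrite -addnBA ?(leq_trans _ h4)// modnDl modn_small ?(leq_ltn_trans (leq_subr 1 _))//.
    by move/eqP; rewrite subn_eq0 leqNgt (leq_trans _ h4).
  - by move=> h0; rewrite h0 in h4.
  - by rewrite modn_small.
have [N0|] := pselect (neighbourhood (2 ^ l) h 0 z); last by exists 0%N.
exists K./2 => // Nh.
have := Re_neighbourhood K7 halfK z0 Nh.
have := Re_neighbourhood K7 K_gt0 z0 N0.
(* The two midpoints are antipodal, so the two real parts have opposite signs. *)
have -> : - (pi * (K./2).*2.+1%:R / K%:R) = - (pi * 1 / K%:R) - pi :> R.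
  by rewrite -KE -natr1; field.
set x := pi * _ / _; have -> : cis (- x - pi) = - cis (- x).
  by rewrite -opprD /Defs.cis !cosN !sinN cosDpi sinDpi; apply/eqP; rewrite eq_complex /= !eqxx.
by rewrite mulrN; case: (z * _) => a b /=; rewrite oppr_gt0 => /lt_trans/[apply]; rewrite ltxx.
Qed.

End Neighbourhoods.

(** * Trigonometric estimates and limits *)

Section Angles.
Variable R : realType.
Implicit Types w x : R.

Lemma cos3E w : cos (3 * w) = 4 * cos w ^+ 3 - 3 * cos w.
Proof.
have -> : 3 * w = w *+ 2 + w by rewrite mulr2n; ring.
rewrite cosD cos_mulr2n sin_mulr2n.
have -> : cos w * sin w *+ 2 * sin w = 2 * cos w * sin w ^+ 2.
  by rewrite mulr2n; ring.
by rewrite sin2cos2 mulr2n; ring.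
Qed.

Lemma sin3E w : sin (3 * w) = 3 * sin w - 4 * sin w ^+ 3.
Proof.
have -> : 3 * w = w *+ 2 + w by rewrite mulr2n; ring.
rewrite sinD cos_mulr2n sin_mulr2n.
have -> : cos w * sin w *+ 2 * cos w = 2 * sin w * cos w ^+ 2.
  by rewrite mulr2n; ring.
by rewrite cos2sin2 mulr2n; ring.
Qed.

(** Two half-angle steps from [cos (pi / 2) = 0]. The value 7/8 suffices for both later uses:
    [2 - 2 * c <= 1 / 4] puts an arc within distance 1/2 of its midpoint, and [4 * c ^+ 2 >= 3]
    makes [cos (3 * w)] nonnegative. *)
Lemma cos_pi8_ge : 7 / 8 <= cos (pi / 8 : R).
Proof.
have c4 : 0 < cos (pi / 4 : R) by apply: cos_gt0_pihalf; have := @pi_gt0 R; lra.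
have c8 : 0 < cos (pi / 8 : R) by apply: cos_gt0_pihalf; have := @pi_gt0 R; lra.
have := @cos_mulr2n R (pi / 4); have := @cos_mulr2n R (pi / 8).
have -> : (pi / 8) *+ 2 = pi / 4 :> R by rewrite mulr2n; field.
have -> : (pi / 4) *+ 2 = pi / 2 :> R by rewrite mulr2n; field.
rewrite cos_pihalf !mulr2n => e8 e4.
have h4 : 7 / 10 <= cos (pi / 4 : R) by nra.
nra.
Qed.

(** [sin (6 * x) = 2 * sin (3 * x) * cos (3 * x)], and [sin (3 * x) <= 3 * sin x] by the
    triple-angle formula. At [x = pi / (2 * k)] it bounds [theta] from below. *)
Lemma sin6_le x : 0 <= 3 * x <= pi -> 0 <= x <= pi -> sin (6 * x) <= 6 * sin x.
Proof.
move=> x3 x1; have := sin_ge0_pi x1; have := sin_ge0_pi x3.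
have -> : 6 * x = (3 * x) *+ 2 by rewrite mulr2n; ring.
rewrite sin_mulr2n mulr2n.
have := cos_le1 (3 * x); have := sin3E x => e s3 s1 c1.
have : sin (3 * x) <= 3 * sin x.
  by rewrite e lerBlDr lerDl mulr_ge0 ?exprn_ge0.
nra.
Qed.

Lemma theta_ge k : (6 <= k)%N -> 3^-1 <= theta R k.
Proof.
move=> k6; have kR : 6 <= (k%:R : R) by rewrite ler_nat.
have k0 : (k%:R : R) != 0 by rewrite lt0r_neq0// (lt_le_trans _ kR).
have [w [wE w0 w6]] : exists w, [/\ w = pi / k%:R :> R, 0 < w & 6 * w <= pi].
  exists (pi / k%:R); split=> //; first by rewrite divr_gt0 ?pi_gt0// (lt_le_trans _ kR).
  rewrite mulrA ler_pdivrMr ?(lt_le_trans _ kR)// mulrC ler_wpM2l ?pi_ge0//.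
rewrite /theta.
have -> : pi / (2 * k%:R) = w / 2 :> R by rewrite wE; field.
have -> : 3 * pi / k%:R = 6 * (w / 2) :> R by rewrite wE; field.
have s6 : 0 < sin (6 * (w / 2)) by apply: sin_gt0_pi; lra.
rewrite ler_pdivlMr// ler_pdivrMl//.
have : sin (6 * (w / 2)) <= 6 * sin (w / 2) by apply: sin6_le; lra.
lra.
Qed.

(** The quotient is the difference quotient of sine at 0, whose limit is [cos 0], taken along the
    sequence [u]. *)
Lemma sinc_cvg (u : R ^nat) : (forall n, u n != 0) -> u @ \oo --> 0 ->
  (fun n => sin (u n) / u n) @ \oo --> (1 : R).
Proof.
move=> u0 ucvg.
have : h^-1 *: ((@sin R \o shift 0) (h *: 1) - sin 0) @[h --> (0 : R)^'] --> (1 : R).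
  rewrite -[X in _ --> X](@cos0 R) -(@derive_val _ _ _ _ _ _ _ (is_derive_sin (0 : R))).
  exact: derivable_sin.
move=> /cvgr_dnbhsP/(_ u (conj u0 ucvg)); apply: cvg_trans; apply: near_eq_cvg.
near=> n; rewrite /= sin0 subr0 addr0 /GRing.scale /= mulr1 mulrC //.
Unshelve. all: by end_near. Qed.

Lemma pi_div_cvg (a : R) : a / n.+1%:R @[n --> \oo] --> (0 : R).
Proof.
rewrite -[X in _ --> X](mulr0 a); apply: cvgMr; exact: cvg_harmonic.
Qed.

Lemma delta_minus_cvg : delta_minus R k / (3 * pi / k%:R) @[k --> \oo] --> (1 : R).
Proof.
rewrite -(cvg_shiftS (fun k => delta_minus R k / (3 * pi / k%:R))).
apply: sinc_cvg; last exact: pi_div_cvg.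
by move=> n; rewrite !mulf_neq0 ?invr_eq0 ?pnatr_eq0// lt0r_neq0 ?pi_gt0.
Qed.

Lemma theta_cvg : theta R k @[k --> \oo] --> (3^-1 : R).
Proof.
rewrite -(cvg_shiftS (@theta R)).
have pi0 : pi != 0 :> R by rewrite lt0r_neq0 ?pi_gt0.
have num : (fun n => sin ((pi / 2) / n.+1%:R) / ((pi / 2) / n.+1%:R)) @ \oo --> (1 : R).
  apply: sinc_cvg; last exact: pi_div_cvg.
  by move=> n; rewrite !mulf_neq0 ?invr_eq0 ?pnatr_eq0.
have den : (fun n => sin (3 * pi / n.+1%:R) / (3 * pi / n.+1%:R)) @ \oo --> (1 : R).
  apply: sinc_cvg; last exact: pi_div_cvg.
  by move=> n; rewrite !mulf_neq0 ?invr_eq0 ?pnatr_eq0.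
(* The factor 1/3 is [2 * (pi / 2) / (3 * pi)], the ratio left once both sines are divided by their
   arguments. *)
have : (fun n => 3^-1 * ((sin ((pi / 2) / n.+1%:R) / ((pi / 2) / n.+1%:R)) /
    (sin (3 * pi / n.+1%:R) / (3 * pi / n.+1%:R)))) @ \oo --> (3^-1 * (1 / 1) : R).
  by apply: cvgMr; apply: cvgM num _; apply: cvgV => //; exact: oner_neq0.
rewrite divr1 mulr1; apply: cvg_trans; apply: near_eq_cvg.
near=> n; rewrite /theta /=.
have n0 : (n.+1%:R : R) != 0 by rewrite pnatr_eq0.
have -> : pi / (2 * n.+1%:R) = pi / 2 / n.+1%:R :> R by field.
set a := sin _; set b := sin _; rewrite [(b / _)^-1]invf_div.
have -> : 3^-1 * (a / (pi / 2 / n.+1%:R) * (3 * pi / n.+1%:R / b)) =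
   (3^-1 * (3 * pi / n.+1%:R) / (pi / 2 / n.+1%:R)) * a / b by ring.
have cancel (p q : R) : p != 0 -> q != 0 -> 3^-1 * (3 * p / q) / (p / 2 / q) = 2.
  by move=> p0 q0; field; rewrite q0 p0.
by rewrite cancel.
Unshelve. all: by end_near. Qed.

End Angles.

(** * Low-rank approximation of one admissible block *)

Section Block.
Variable R : realType.

Local Notation normc := (@Normc.normc R).
Local Notation cis := (@cis R).
Local Notation Re := (@complex.Re R).

Variables (m n : nat) (s : 'I_m -> R[i]) (t : 'I_n -> R[i]) (gamma c : R).
Hypothesis st : forall i j, s i != t j.
Hypothesis c_ge : 7 / 8 <= c < 1.
Hypothesis t1 : forall j, normc (t j) = 1.
Hypothesis t_near : forall j, c <= Re (t j * cis (- gamma)).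

Let s' i := s i * cis (- gamma).
Let t' j := t j * cis (- gamma).

Let st'E i j : s' i - t' j = (s i - t j) * cis (- gamma).
Proof. by rewrite mulrBl. Qed.

Let normc_t' j : normc (t' j) = 1.
Proof. by rewrite Normc.normcM normc_cis mulr1. Qed.

Let st0 i j : s i - t j != 0. Proof. by rewrite subr_eq0. Qed.

Lemma xi_rank_taylor (D xi : R) (rho : nat) :
  0 < D -> (forall i, D <= normc (s i - cis gamma)) -> (D^-1 / 2) ^+ rho <= xi ->
  (xi_rank xi (cauchy_mx s t) <= rho)%N /\ (xi_rank xi (cauchy_mx s t)^T <= rho)%N.
Proof.
move=> D0 sD Dxi.
have s0 i : s' i - 1 != 0.
  apply/eqP => h; have := sD i; rewrite -normcB_cis -/(s' i) h Normc.normc0.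
  by rewrite leNgt D0.
(* The factor [cis (- gamma)] compensates for the rotation, since the block contains [s i - t j] and
   not [s' i - t' j]. The bound 1/2 on [t' j - 1] comes from [c >= 7 / 8]. *)
apply: (@xi_rank_displacement_tr _ _ _ _ (fun i => (s' i - 1)^-1)
  (fun i => cis (- gamma) / (s' i - 1)) (fun j => t' j - 1) (fun=> 1) D^-1 2^-1) => //.
- by rewrite invr_ge0 ltW.
- move=> i; rewrite Normc.normcV lef_pV2 ?posrE ?normc_gt0//.
  by rewrite normcB_cis.
- move=> j; rewrite -(@ler_pXn2r _ 2) ?nnegrE ?normc_ge0//.
  rewrite sq_normcB1 normc_t'; have /andP[c7 _] := c_ge.
  by have := t_near j; rewrite -/(t' j); lra.
move=> i j; rewrite mxE mulr1.
have -> : 1 - (s' i - 1)^-1 * (t' j - 1) = (s' i - t' j) / (s' i - 1) by field.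
by rewrite st'E; field; rewrite s0 st0.
Qed.

(* The Cayley transform [z |-> (z - 1) / (z + 1)] sends the arc of half-angle [w]
   ([c = cos w]) into the disc of radius [tan (w / 2)] and the complement of the
   sector of half-angle [3 w] outside that of radius [tan (3 w / 2)], and
   [tan (w / 2) / tan (3 w / 2) = (2 c - 1) / (2 c + 1) <= 1 / 3]. *)
Lemma xi_rank_cayley (xi : R) (rho : nat) :
  (forall i, Re (s i * cis (- gamma)) <= normc (s i) * (4 * c ^+ 3 - 3 * c)) ->
  3^-1 ^+ rho <= xi ->
  (xi_rank xi (cauchy_mx s t) <= rho)%N /\ (xi_rank xi (cauchy_mx s t)^T <= rho)%N.
Proof.
move=> s_far xi3; have /andP[c7 c1] := c_ge.
set C := 4 * c ^+ 3 - 3 * c in s_far.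
(* For [c = cos w], [C] is [cos (3 * w)]. These factorisations turn the product of the two squared
   radii into the square of [(2 * c - 1) / (2 * c + 1)]. *)
have CD : 1 + C = (1 + c) * (2 * c - 1) ^+ 2 by rewrite /C; ring.
have CB : 1 - C = (1 - c) * (2 * c + 1) ^+ 2 by rewrite /C; ring.
have C0 : 0 <= C.
  have -> : C = c * (4 * c ^+ 2 - 3) by rewrite /C; ring.
  by rewrite mulr_ge0; nra.
clearbody C.
have C1 : C < 1 by rewrite -subr_gt0 CB mulr_gt0 ?exprn_gt0//; lra.
have s_far' i : Re (s' i) <= normc (s' i) * C.
  by rewrite Normc.normcM normc_cis mulr1; exact: s_far.
have s0 i : s' i - 1 != 0.
  apply/eqP => h; have := sq_normcB1_ge (s_far' i); rewrite h Normc.normc0; nra.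
have t0 j : t' j + 1 != 0.
  apply/eqP => h; have := sq_normcD1 (t' j); rewrite h Normc.normc0 normc_t'.
  by have := t_near j; rewrite -/(t' j); lra.
apply: (@xi_rank_displacement_tr _ _ _ _ (fun i => (s' i + 1) / (s' i - 1))
  (fun i => 2 * cis (- gamma) / (s' i - 1)) (fun j => (t' j - 1) / (t' j + 1))
  (fun j => (t' j + 1)^-1)
  (Num.sqrt ((1 + C) / (1 - C))) (Num.sqrt ((1 - c) / (1 + c)))) => //.
- apply: le_trans xi3; rewrite lerXn2r ?nnegrE ?mulr_ge0 ?sqrtr_ge0 ?invr_ge0//.
  rewrite -sqrtrM; last by apply: divr_ge0; lra.
  have -> : (1 + C) / (1 - C) * ((1 - c) / (1 + c)) = ((2 * c - 1) / (2 * c + 1)) ^+ 2.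
    rewrite CD CB; field; apply/and3P; split; rewrite lt0r_neq0//; lra.
  rewrite sqrtr_sqr ger0_norm; last by rewrite divr_ge0//; lra.
  rewrite ler_pdivrMr; lra.
- move=> i; rewrite -[leLHS]ger0_norm ?normc_ge0// -sqrtr_sqr ler_wsqrtr//.
  rewrite Normc.normcM Normc.normcV expr_div_n ler_pdivlMr ?subr_gt0//.
  rewrite mulrAC ler_pdivrMr ?exprn_gt0 ?normc_gt0//.
  by rewrite [leRHS]mulrC; apply: sq_normcD1_le.
- move=> j; rewrite -[leLHS]ger0_norm ?normc_ge0// -sqrtr_sqr ler_wsqrtr//.
  rewrite Normc.normcM Normc.normcV expr_div_n ler_pdivlMr; last lra.
  rewrite mulrAC ler_pdivrMr ?exprn_gt0 ?normc_gt0//.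
  rewrite sq_normcB1 sq_normcD1 normc_t'.
  by have := t_near j; rewrite -/(t' j); lra.
move=> i j; rewrite mxE.
have -> : 1 - (s' i + 1) / (s' i - 1) * ((t' j - 1) / (t' j + 1)) =
   2 * (s' i - t' j) / ((s' i - 1) * (t' j + 1)) by field; rewrite s0 t0.
by rewrite st'E; field; rewrite s0 st0 t0.
Qed.

Lemma xi_rank_cauchy (D th : R) (rho : nat) :
  (forall i, Re (s i * cis (- gamma)) <= normc (s i) * (4 * c ^+ 3 - 3 * c)) ->
  0 < D -> (forall i, D <= normc (s i - cis gamma)) ->
  3^-1 <= th < 1 -> (0 < rho)%N ->
  (xi_rank (xi_bound th D rho) (cauchy_mx s t) <= rho)%N /\
  (xi_rank (xi_bound th D rho) (cauchy_mx s t)^T <= rho)%N.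
Proof.
move=> s_far D0 sD /andP[th3 th1] rho0.
have th0 : 0 < th by lra.
have thD : 0 < (1 - th) * D by rewrite mulr_gt0// subr_gt0.
(* At most 3/2, [(1 - th) * D <= (2 / 3) * (3 / 2) = 1], so the denominator of [xi_bound] only
   enlarges it. *)
have [Dle|Dgt] := leP D (3 / 2).
  apply: xi_rank_cayley => //; rewrite /xi_bound ler_pdivlMr//.
  apply: (@le_trans _ _ (th ^+ rho * 1)).
    apply: ler_pM => //; [exact: ltW| |nra].
    by rewrite lerXn2r ?nnegrE// ltW.
  by rewrite mulr1.
apply: (@xi_rank_taylor D) => //; rewrite /xi_bound.
(* Of the [r.+1] factors, [r] are compared with [th]; the last one times [(1 - th) * D] equals
   [(1 - th) / 2], which is at most [th] because [th >= 1 / 3]. *)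
case: rho rho0 => // r _; rewrite !exprSr -mulrA.
have Dth : D^-1 / 2 <= th.
  apply: le_trans th3; rewrite ler_pdivrMr// -[leLHS]mul1r ler_pdivrMr//; lra.
have D20 : 0 <= D^-1 / 2 by rewrite divr_ge0 ?invr_ge0 ?(ltW D0).
apply: ler_pM => //; first exact: exprn_ge0.
  by rewrite lerXn2r ?nnegrE// ltW.
rewrite ler_pdivlMr//.
have -> : D^-1 / 2 * ((1 - th) * D) = (1 - th) / 2 by field; rewrite lt0r_neq0.
lra.
Qed.

End Block.

(** * The merging stages *)

Section Stages.
Variable R : realType.

Local Notation normc := (@Normc.normc R).
Local Notation Re := (@complex.Re R).

Lemma xi_rank_le_mono m n (M : 'M[R[i]]_(m, n)) (xi xi' : R) (rho : nat) :
  0 <= xi <= xi' -> (xi_rank xi M <= rho)%N -> (xi_rank xi' M <= rho)%N.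
Proof.
move=> /andP[xi0 xixi'] /xi_rank_leP H.
have M0 := spectral_norm_ge0 M.
have [N [NM rN]] := H (mulr_ge0 xi0 M0).
apply/xi_rank_leP; first by rewrite mulr_ge0// (le_trans xi0).
by exists N; split=> //; apply: le_trans NM _; rewrite ler_wpM2r.
Qed.

Variables (l h m : nat) (s : 'I_m -> R[i]).
Hypothesis hl : (h <= l)%N.
Let k := (2 ^ l)%N.
Let K := num_sectors k h.
Hypothesis K8 : (8 <= K)%N.

Let KR8 : 8 <= (K%:R : R). Proof. by rewrite ler_nat. Qed.

Let angle_le : 0 < (pi / K%:R : R) <= pi / 8.
Proof.
have K0 : 0 < (K%:R : R) by apply: lt_le_trans KR8.
by rewrite divr_gt0 ?pi_gt0//= ler_wpM2l ?pi_ge0// lef_pV2 ?posrE.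
Qed.

Let angle3 : 3 * pi / K%:R = 3 * (pi / K%:R) :> R. Proof. by rewrite mulrA. Qed.

Let cos_angle : 7 / 8 <= cos (pi / K%:R : R) < 1.
Proof.
have /andP[w0 w8] := angle_le; have pi0 := @pi_gt0 R; apply/andP; split.
  apply: le_trans (@cos_pi8_ge R) _; apply: le_cos_norm; last lra.
  by rewrite ger0_norm // ltW.
by rewrite -[ltRHS](@cos0 R) ltr_cos ?in_itv /=; lra.
Qed.

Lemma Re_admissible_s q i : (q < K)%N -> i \in admissible_s s k h q ->
  Re (s i * cis (- (pi * q.*2.+1%:R / K%:R))) <= normc (s i) * cos (3 * (pi / K%:R)).
Proof.
move=> qK; rewrite inE => /asboolP sN; rewrite -angle3.
by apply: Re_not_neighbourhood => //; apply: leq_trans K8.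
Qed.

(** Merging only widens the sectors: [3 * pi / k <= 3 * pi / K < pi / 2], where sine increases, and
    [sin (3 * pi / K)] bounds the distance at the current stage. *)
Lemma delta_minus_le_normc q i : (q < K)%N -> i \in admissible_s s k h q ->
  delta_minus R k <= normc (s i - arc_midpoint R k h q).
Proof.
move=> qK iN; have /andP[w0 w8] := angle_le; have pi0 := @pi_gt0 R.
apply: (@le_trans _ _ (sin (3 * (pi / K%:R)))).
  have kK : (K%:R : R) <= k%:R by rewrite ler_nat leq_div.
  have wk : pi / k%:R <= pi / K%:R :> R.
    have K0 : 0 < (K%:R : R) by apply: lt_le_trans KR8.
    by rewrite ler_wpM2l ?pi_ge0// lef_pV2 ?posrE// (lt_le_trans _ kK).
  have wk0 : 0 <= pi / k%:R :> R by rewrite divr_ge0 ?pi_ge0.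
  rewrite /delta_minus -mulrA leNgt ltr_sin ?in_itv/=; last 2 first.
  - lra.
  - lra.
  by rewrite -leNgt ler_wpM2l.
rewrite /arc_midpoint -normcB_cis -(@ler_pXn2r _ 2) ?nnegrE ?normc_ge0//; last first.
  by apply: sin_ge0_pi; lra.
by rewrite sin2cos2; apply: sq_normcB1_ge; rewrite Normc.normcM normc_cis mulr1 Re_admissible_s.
Qed.

Lemma delta_le_normc q i : (q < K)%N -> i \in admissible_s s k h q ->
  delta s k h <= normc (s i - arc_midpoint R k h q).
Proof.
move=> qK iN; apply: ge_inf; last by exists q, i.
by exists 0 => _ [? [? [_ _ ->]]]; exact: normc_ge0.
Qed.

Lemma delta_minus_le_delta : (0 < m)%N -> delta_minus R k <= delta s k h.
Proof.
move=> m0; apply: lb_le_inf; last first.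
  by move=> _ [q [i [qK iN ->]]]; exact: delta_minus_le_normc.
(* Without a member the infimum would take its default value 0; any knot, here the first, provides
   one. *)
have [q qK sN] := exists_not_neighbourhood hl (s (Ordinal m0)) K8.
exists (normc (s (Ordinal m0) - arc_midpoint R k h q)), q, (Ordinal m0).
by split=> //; rewrite inE; apply/asboolP.
Qed.

Lemma stage_xi_rank_le_cauchy n (t : 'I_n -> R[i]) (rho : nat) :
  (forall i j, s i <> t j) -> (0 < m)%N -> 0 < delta_minus R k ->
  3^-1 <= theta R k < 1 -> (0 < rho)%N ->
  let xi := xi_bound (theta R k) (delta s k h) rho in
  stage_xi_rank_le (cauchy_mx s t) (admissible_s s k) (admissible_t t k) k h xi rho /\
  stage_xi_rank_le (cauchy_mx s t)^T (admissible_t t k) (admissible_s s k) k h xi rho.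
Proof.
move=> st m0 dm0 th rho0 xi.
suff H q : (q < K)%N ->
    let I := admissible_s s k h q in let J := admissible_t t k h q in
    (xi_rank xi (block (cauchy_mx s t) I J) <= rho)%N /\
    (xi_rank xi (block (cauchy_mx s t)^T J I) <= rho)%N.
  by split=> q qK; case: (H q qK).
move=> qK I J.
have sI (i : 'I_#|I|) : enum_val i \in I by exact: enum_valP.
have tJ (j : 'I_#|J|) : Defs.arc k h q (t (enum_val j)).
  by apply/asboolP; have := enum_valP j; rewrite inE.
have -> : block (cauchy_mx s t) I J =
    cauchy_mx (fun i : 'I_#|I| => s (enum_val i)) (fun j : 'I_#|J| => t (enum_val j)).
  by apply/matrixP => i j; rewrite !mxE.
have -> : block (cauchy_mx s t)^T J I =
    (cauchy_mx (fun i : 'I_#|I| => s (enum_val i)) (fun j : 'I_#|J| => t (enum_val j)))^T.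
  by apply/matrixP => i j; rewrite !mxE.
apply: (@xi_rank_cauchy R _ _ _ _ (pi * q.*2.+1%:R / K%:R) (cos (pi / K%:R))) => //.
- by move=> i j; apply/eqP.
- by move=> j; case: (arc_polar hl qK (tJ j)).
- by move=> j; case: (arc_polar hl qK (tJ j)).
- by move=> i; rewrite -cos3E; apply: Re_admissible_s.
- exact: lt_le_trans (delta_minus_le_delta m0).
- by move=> i; apply: delta_le_normc.
Qed.

End Stages.

Theorem theorem6p2 (R : realType) :
  (exists k0 : nat,
    forall (l_plus k l m n : nat) (f : R[i]) (s : 'I_m -> R[i]),
      k = (2 ^ l_plus)%N -> (k0 <= k)%N -> (2 * k < n)%N ->
      (l < l_plus)%N -> (6 <= 2 ^ (l_plus - l))%N -> (0 < m)%N ->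
      Normc.normc f = 1 ->
      (forall (i : 'I_m) (j : 'I_n), s i <> cv_knot f j) ->
      let C := cauchy_mx s (@cv_knot R n f) in
      let N_s := admissible_s s k in
      let N_t := admissible_t (@cv_knot R n f) k in
      (forall h, (h <= l)%N -> delta_minus R k <= delta s k h) /\
      (forall rho : nat, (0 < rho)%N ->
        exists xi : nat -> R,
          (forall h, (h <= l)%N ->
            [/\ 0 <= xi h,
                xi h <= xi_bound (theta R k) (delta s k h) rho,
                stage_xi_rank_le C N_s N_t k h (xi h) rho
              & stage_xi_rank_le C^T N_t N_s k h (xi h) rho]) /\
          (let xi_max := \big[Num.max/0]_(h < l.+1) xi h in
            extended_balanced_HSS C N_s N_t k l xi_max rho /\
            extended_balanced_HSS C^T N_t N_s k l xi_max rho))) /\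
  theta R k @[k --> \oo] --> (3^-1 : R) /\
  delta_minus R k / (3 * pi / k%:R) @[k --> \oo] --> (1 : R).
Proof.
split; last by split; [exact: theta_cvg | exact: delta_minus_cvg].
(* This fixes what sufficiently large means: [k0] is a threshold beyond which [theta R k < 1]. *)
have th_lt1 : \forall k \near \oo, theta R k < 1.
  by apply: cvgr_lt (@theta_cvg R) _ _; lra.
have [k0 _ thk0] := th_lt1; exists k0.
move=> lp k l m n f s kE k0k _ llp l6 m0 _ st C N_s N_t.
(* A power of two that is at least 6 is at least 8, so every stage keeps at least 8 sectors. *)
have lp3 : (3 <= lp - l)%N.
  rewrite leqNgt; apply/negP => lt3; move: l6; rewrite leqNgt ltnS.
  by case: (lp - l)%N lt3 => [|[|[|]]].
have hlp h : (h <= l)%N -> (h <= lp)%N by move=> hl; apply: leq_trans hl (ltnW llp).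
have K8 h : (h <= l)%N -> (8 <= num_sectors (2 ^ lp) h)%N.
  move=> hl; rewrite num_sectorsE ?hlp // (@leq_exp2l 2 3) //.
  by apply: leq_trans lp3 _; rewrite leq_sub2l.
have k8 : (8 <= k)%N by have := K8 0%N (leq0n _); rewrite /num_sectors expn0 divn1 kE.
have kR : 8 <= (k%:R : R) by rewrite ler_nat.
have dm0 : 0 < delta_minus R k.
  have k0' : 0 < (k%:R : R) by apply: lt_le_trans kR.
  apply: sin_gt0_pi; rewrite divr_gt0 ?mulr_gt0 ?pi_gt0//= ltr_pdivrMr//.
  have := @pi_gt0 R; nra.
have th : 3^-1 <= theta R k < 1.
  by rewrite theta_ge ?(leq_trans _ k8)//=; apply: thk0.
have dh h : (h <= l)%N -> delta_minus R k <= delta s k h.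
  by move=> hl; rewrite kE; apply: delta_minus_le_delta => //; [exact: hlp|exact: K8].
(* Each stage takes the largest value that the bound permits. *)
split=> // rho rho0; exists (fun h => xi_bound (theta R k) (delta s k h) rho).
have xi0 h : (h <= l)%N -> 0 <= xi_bound (theta R k) (delta s k h) rho.
  move=> hl; have /andP[th3 th1] := th; rewrite /xi_bound.
  have d0 : 0 < delta s k h := lt_le_trans dm0 (dh h hl).
  by rewrite divr_ge0 ?mulr_ge0 ?exprn_ge0 ?subr_ge0 ?(ltW th1) ?(ltW d0)//; lra.
pose xi h := xi_bound (theta R k) (delta s k h) rho.
have stage h : (h <= l)%N -> stage_xi_rank_le C N_s N_t k h (xi h) rho /\
    stage_xi_rank_le C^T N_t N_s k h (xi h) rho.
  move=> hl; rewrite /xi /N_s /N_t; move: dm0 th; rewrite kE => dm0 th.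
  by apply: stage_xi_rank_le_cauchy => //; [exact: hlp | exact: K8].
split=> [h hl|xi_max]; first by have [] := stage h hl; split=> //; exact: xi0.
(* The HSS property asks for one tolerance at all stages; the rank bounds pass to the maximum by
   monotonicity in [xi]. *)
have xi_le h : (h <= l)%N -> 0 <= xi h <= xi_max.
  by move=> hl; rewrite xi0//=; apply: (le_bigmax _ (fun h : 'I_l.+1 => xi h) (Ordinal (hl : h < l.+1)%N)).
by split=> h hl q qK; apply: xi_rank_le_mono (xi_le h hl) _; have [] := stage h hl; auto.
Qed.
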